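(* Let $r_{\mathfrak g},r_{\mathfrak h}$ be skew-symmetric classical $r$-matrices in finite-dimensional Lie algebras $\mathfrak g$ and $\mathfrak h$ (over a field $K$) respectively. Let $\phi:\mathfrak g\to\mathfrak h$ be a Lie algebra homomorphism and $\psi:\mathfrak h\to\mathfrak g$ a linear map. Then $(\phi,\psi)$ is a coherent homomorphism of classical $r$-matrices from $r_{\mathfrak g}$ to $r_{\mathfrak h}$ if and only if $(\phi,\psi^* )$ is a homomorphism of $\mathcal O$-operators from $r_{\mathfrak g}^\sharp$ to $r_{\mathfrak h}^\sharp$. This correspondence ($r\mapsto r^\sharp$, $(\phi,\psi)\mapsto(\phi,\psi^* )$) defines an equivalence from the category $\mathbf{SCr}$ of skew-symmetric classical $r$-matrices (a full subcategory of the category of classical $r$-matrices $r$ satisfying $(\mathrm{ad}(x)\otimes\mathrm{id}+\mathrm{id}\otimes\mathrm{ad}(x))(r+\tau(r))=0$ for all $x$, with coherent homomorphisms) to the category $\mathbf{SOP}_{\mathrm{coad}}$ of those $\mathcal O$-operators $T:\mathfrak g^*\to\mathfrak g$ on Lie algebras $\mathfrak g$ associated to the coadjoint representations $(\mathfrak g^*,\mathrm{ad}^* )$ which satisfy $\langle T(a^* ),b^*\rangle+\langle a^*,T(b^* )\rangle=0$ for all $a^*,b^*\in\mathfrak g^*$ (a full subcategory of the category $\mathbf{OP}$ of $\mathcal O$-operators).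
   Context: For a linear map $\varphi$, $\varphi^*$ denotes its transpose. For a representation $\rho$ of a Lie algebra on $V$, $\rho^*(x):=-\rho(x)^*$ on $V^*$; $\mathrm{ad}^*$ is the coadjoint representation. $\tau$ is the flip map on $\mathfrak g\otimes\mathfrak g$. A classical $r$-matrix in $\mathfrak g$ is $r=\sum_i a_i\otimes b_i\in\mathfrak g\otimes\mathfrak g$ with $[r_{12},r_{13}]+[r_{13},r_{23}]+[r_{12},r_{23}]=0$, where $[r_{12},r_{13}]=\sum_{i,j}[a_i,a_j]\otimes b_i\otimes b_j$, $[r_{13},r_{23}]=\sum_{i,j}a_i\otimes a_j\otimes[b_i,b_j]$, $[r_{12},r_{23}]=\sum_{i,j}a_i\otimes[b_i,a_j]\otimes b_j$. It is skew-symmetric if $r=-\tau(r)$. For $r=\sum_i a_i\otimes b_i$, $r^\sharp:\mathfrak g^*\to\mathfrak g$ is $r^\sharp(a^* )=\sum_i\langle a^*,a_i\rangle b_i$. Coherent homomorphism of classical $r$-matrices from $r_{\mathfrak g}$ to $r_{\mathfrak h}$: a pair $(\phi,\psi)$ with $\phi:\mathfrak g\to\mathfrak h$ a Lie algebra homomorphism and $\psi:\mathfrak h\to\mathfrak g$ linear such that $(\psi\otimes\mathrm{id}_{\mathfrak h})(r_{\mathfrak h})=(\mathrm{id}_{\mathfrak g}\otimes\phi)(r_{\mathfrak g})$, $(\mathrm{id}_{\mathfrak h}\otimes\psi)(r_{\mathfrak h})=(\phi\otimes\mathrm{id}_{\mathfrak g})(r_{\mathfrak g})$, and $\psi[\phi(x),y]_{\mathfrak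 h}=[x,\psi(y)]_{\mathfrak g}$ for all $x\in\mathfrak g,y\in\mathfrak h$. Composition: $(\phi_2,\psi_2)(\phi_1,\psi_1)=(\phi_2\phi_1,\psi_1\psi_2)$. An $\mathcal O$-operator on a Lie algebra $\mathfrak g$ associated to a representation $(V,\rho)$ is a linear map $T:V\to\mathfrak g$ with $[T(u),T(v)]=T(\rho(T(u))v-\rho(T(v))u)$ for all $u,v\in V$. It is known that for skew-symmetric $r$, $r$ is a classical $r$-matrix iff $r^\sharp$ is an $\mathcal O$-operator associated to $(\mathfrak g^*,\mathrm{ad}^* )$. A (coherent) homomorphism of $\mathcal O$-operators from $T_{\mathfrak g}:V_{\mathfrak g}\to\mathfrak g$ (associated to $(V_{\mathfrak g},\rho_{\mathfrak g})$) to $T_{\mathfrak h}:V_{\mathfrak h}\to\mathfrak h$ (associated to $(V_{\mathfrak h},\rho_{\mathfrak h})$) is a pair $(\phi,\alpha)$ with $\phi:\mathfrak g\to\mathfrak h$ a Lie algebra homomorphism and $\alpha:V_{\mathfrak g}\to V_{\mathfrak h}$ linear such that $\alpha(\rho_{\mathfrak g}(x)v)=\rho_{\mathfrak h}(\phi(x))(\alpha(v))$ for all $x\in\mathfrak g,v\in V_{\mathfrak g}$, and $T_{\mathfrak h}\alpha=\phi T_{\mathfrak g}$. $\mathbf{OP}$ is the category of $\mathcal O$-operators with these morphisms (composed componentwise). All spaces are finite dimensional. *)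

(* Defs.v *)
From HB Require Import structures.
From mathcomp Require Import all_boot all_order all_algebra.
From mathcomp Require boolp.

Set Implicit Arguments.
Unset Strict Implicit.
Unset Printing Implicit Defensive.

Import GRing.Theory.
Local Open Scope ring_scope.

(* The dual space is 'Hom(V, K^o), and the pairing <a, v> is the value a v. *)
Definition dual (K : fieldType) (V : vectType K) : vectType K := 'Hom(V, K^o).

Definition pairing (K : fieldType) (V : vectType K) (a : dual V) (v : V) : K :=
  (a : 'Hom(V, K^o)) v.

Section Transpose.
Variables (K : fieldType) (U V : vectType K).

Definition transpose_fun (f : 'Hom(U, V)) (a : dual V) : dual U :=
  ((a : 'Hom(V, K^o)) \o f)%VF.

Fact transpose_fun_is_linear f : linear (transpose_fun f).
Proof.
by move=> k a b; rewrite /transpose_fun comp_lfunDl comp_lfunZl.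
Qed.

HB.instance Definition _ f :=
  GRing.isLinear.Build K (dual V) (dual U) _ (transpose_fun f)
    (transpose_fun_is_linear f).

Definition transpose (f : 'Hom(U, V)) : 'Hom(dual V, dual U) :=
  linfun (transpose_fun f).

Lemma pairing_transpose f a u :
  pairing (transpose f a) u = pairing a (f u).
Proof. by rewrite /transpose lfunE /= /transpose_fun /pairing comp_lfunE. Qed.

End Transpose.

Section Pairing.
Variables (K : fieldType) (V : vectType K).

Lemma pairingDl (a b : dual V) v : pairing (a + b) v = pairing a v + pairing b v.
Proof. exact: (add_lfunE (a : 'Hom(V, K^o))). Qed.

Lemma pairingNl (a : dual V) v : pairing (- a) v = - pairing a v.
Proof. exact: (opp_lfunE (a : 'Hom(V, K^o))). Qed.

Lemma pairingZl k (a : dual V) v : pairing (k *: a) v = k * pairing a v.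
Proof. exact: (scale_lfunE k (a : 'Hom(V, K^o))). Qed.

Lemma pairing_linear (a : dual V) : linear (pairing a : V -> K^o).
Proof. by move=> k u v; rewrite /pairing linearP. Qed.

HB.instance Definition _ (a : dual V) :=
  GRing.isLinear.Build K V K^o _ (pairing a : V -> K^o) (pairing_linear a).

Lemma pairingDr (a : dual V) u v : pairing a (u + v) = pairing a u + pairing a v.
Proof. exact: (linearD (a : 'Hom(V, K^o))). Qed.

Lemma pairingNr (a : dual V) v : pairing a (- v) = - pairing a v.
Proof. exact: (linearN (a : 'Hom(V, K^o))). Qed.

Lemma pairingZr (a : dual V) k v : pairing a (k *: v) = k * pairing a v.
Proof. by rewrite /pairing linearZ. Qed.

Lemma dualP (a b : dual V) : (forall v, pairing a v = pairing b v) -> a = b.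
Proof. by move=> eq_ab; apply/lfunP => v; exact: eq_ab. Qed.

Lemma pairing_sep (u v : V) : (forall a : dual V, pairing a u = pairing a v) -> u = v.
Proof.
move=> eq_uv; rewrite (coord_vbasis (memvf u)) (coord_vbasis (memvf v)).
apply: eq_bigr => i _; congr (_ *: _).
have := eq_uv (linfun (coord (vbasis {:V}) i : V -> K^o)).
by rewrite /pairing !lfunE.
Qed.

End Pairing.

(* The tensor product is modelled by coordinates in the bases vbasis; [tensE], *)
(* [tens_linearl], [tens_linearr], [tliftE] and [tens_ext] below are its       *)
(* universal property, so the choice of bases is irrelevant.                   *)
Definition tensor (K : fieldType) (U V : vectType K) : vectType K :=
  'M[K]_(\dim {:U}, \dim {:V}).

Section Tensor.
Variables (K : fieldType) (U V : vectType K).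

Definition tens (u : U) (v : V) : tensor U V :=
  \matrix_(i, j) (coord (vbasis {:U}) i u * coord (vbasis {:V}) j v).

(* The linear map on the tensor product induced by a bilinear map b: it sends *)
(* sum_i a_i (x) b_i to sum_i b a_i b_i.                                        *)
Definition tlift (W : vectType K) (b : U -> V -> W) (t : tensor U V) : W :=
  \sum_i \sum_j
    (t : 'M[K]_(_, _)) i j *: b (vbasis {:U})`_i (vbasis {:V})`_j.

Lemma tlift_is_linear (W : vectType K) (b : U -> V -> W) : linear (tlift b).
Proof.
move=> k s t; rewrite /tlift scaler_sumr -big_split; apply: eq_bigr => i _ /=.
rewrite scaler_sumr -big_split; apply: eq_bigr => j _ /=.
by rewrite !mxE scalerDl scalerA.
Qed.

HB.instance Definition _ (W : vectType K) (b : U -> V -> W) :=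
  GRing.isLinear.Build K (tensor U V) W _ (tlift b) (tlift_is_linear b).

Lemma tens_linearl v : linear (tens^~ v).
Proof.
by move=> k u u'; apply/matrixP => i j; rewrite !mxE linearP mulrDl -mulrA.
Qed.

Lemma tens_linearr u : linear (tens u).
Proof.
move=> k v v'; apply/matrixP => i j; rewrite !mxE linearP mulrDr.
by rewrite mulrCA.
Qed.

Lemma linear_tlift (W W' : vectType K) (L : {linear W -> W'}) (b : U -> V -> W) t :
  L (tlift b t) = tlift (fun u v => L (b u v)) t.
Proof.
rewrite /tlift linear_sum; apply: eq_bigr => i _.
by rewrite linear_sum; apply: eq_bigr => j _; rewrite linearZ.
Qed.

Lemma eq_tlift (W : vectType K) (b b' : U -> V -> W) :
  b =2 b' -> tlift b =1 tlift b'.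
Proof.
by move=> eq_b t; apply: eq_bigr => i _; apply: eq_bigr => j _; rewrite eq_b.
Qed.

Lemma tliftE (W : vectType K) (b : U -> V -> W) u v :
  (forall y, linear (b^~ y)) -> (forall x, linear (b x)) ->
  tlift b (tens u v) = b u v.
Proof.
move=> linl linr.
pose bl y : {linear U -> W} :=
  HB.pack (b^~ y) (GRing.isLinear.Build K U W _ (b^~ y) (linl y)).
pose br x : {linear V -> W} :=
  HB.pack (b x) (GRing.isLinear.Build K V W _ (b x) (linr x)).
rewrite {2}(coord_vbasis (memvf u)) -[RHS]/(bl v _) linear_sum.
apply: eq_bigr => i _; rewrite linearZ /= {2}(coord_vbasis (memvf v)).
rewrite -[b _ _]/(br _ _) linear_sum scaler_sumr; apply: eq_bigr => j _.
by rewrite linearZ scalerA mxE.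
Qed.

Lemma tensE (t : tensor U V) : t = tlift tens t.
Proof.
apply/matrixP => k l; rewrite /tlift summxE (bigD1 k) //= summxE (bigD1 l) //=.
have fU := basis_free (vbasisP {:U}); have fV := basis_free (vbasisP {:V}).
rewrite !mxE !coord_free // !eqxx !mulr1.
rewrite big1 ?addr0 => [|j /negPf jl]; last first.
  by rewrite !mxE !coord_free // jl !mulr0.
rewrite big1 ?addr0 // => i /negPf ik; rewrite summxE big1 // => j _.
by rewrite !mxE !coord_free // ik !(mul0r, mulr0).
Qed.

Lemma tens_ext (W : vectType K) (f g : {linear tensor U V -> W}) :
  (forall u v, f (tens u v) = g (tens u v)) -> f =1 g.
Proof.
by move=> eq_fg t; rewrite (tensE t) !linear_tlift; apply: eq_tlift.
Qed.

End Tensor.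

(* (f (x) g)(t) and the flip map, for linear f and g *)
Definition tmap (K : fieldType) (U U' V V' : vectType K)
    (f : U -> U') (g : V -> V') : tensor U V -> tensor U' V' :=
  tlift (fun u v => tens (f u) (g v)).

Definition flip (K : fieldType) (U V : vectType K) : tensor U V -> tensor V U :=
  tlift (fun u v => tens v u).

Lemma tlift_flip (K : fieldType) (U V W : vectType K) (b : V -> U -> W)
    (t : tensor U V) :
  (forall y, linear (b^~ y)) -> (forall x, linear (b x)) ->
  tlift b (flip t) = tlift (fun u v => b v u) t.
Proof.
move=> linl linr; rewrite /flip (linear_tlift (tlift b)).
by apply: eq_tlift => u v /=; rewrite tliftE.
Qed.

Lemma tmap_comp (K : fieldType) (U U' U'' V V' V'' : vectType K)
    (f : U -> U') (g : V -> V') (f' : U' -> U'') (g' : V' -> V'') t :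
  linear f' -> linear g' ->
  tmap f' g' (tmap f g t) = tmap (fun u => f' (f u)) (fun v => g' (g v)) t.
Proof.
move=> linf ling; rewrite /tmap (linear_tlift (tlift _)).
apply: eq_tlift => u v /=; rewrite tliftE // => x k y z.
  by rewrite linf tens_linearl.
by rewrite ling tens_linearr.
Qed.

Lemma eq_tmap (K : fieldType) (U U' V V' : vectType K)
    (f f' : U -> U') (g g' : V -> V') :
  f =1 f' -> g =1 g' -> tmap f g =1 tmap f' g'.
Proof. by move=> ef eg; apply: eq_tlift => u v; rewrite ef eg. Qed.

HB.mixin Record isLieAlgebra (K : fieldType) (g : Type) of Vector K g := {
  lie : g -> g -> g;
  lie_linearl : forall y, linear (lie^~ y);
  lie_linearr : forall x, linear (lie x);
  liexx : forall x, lie x x = 0;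
  lie_jacobi : forall x y z,
    lie x (lie y z) + lie y (lie z x) + lie z (lie x y) = 0
}.

#[short(type="lieAlgType")]
HB.structure Definition LieAlgebra (K : fieldType) :=
  {g of isLieAlgebra K g & Vector K g}.

Notation "[lie x , y ]" := (lie x y)
  (at level 0, x, y at level 99, format "[lie  x ,  y ]") : ring_scope.

Section LieTheory.
Variables (K : fieldType) (g : lieAlgType K).
Implicit Types x y z : g.

HB.instance Definition _ x := GRing.isLinear.Build K g g _ (lie x) (lie_linearr x).

Definition ad x : 'End(g) := linfun (lie x).

Lemma adE x y : ad x y = [lie x, y]. Proof. exact: lfunE. Qed.

Lemma lieDl x x' y : [lie x + x', y] = [lie x, y] + [lie x', y].
Proof. by have := lie_linearl y 1 x x'; rewrite !scale1r. Qed.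

Lemma lie0l y : [lie 0, y] = 0.
Proof. by apply: (addrI [lie 0, y]); rewrite -lieDl !addr0. Qed.

Lemma lieZl k x y : [lie k *: x, y] = k *: [lie x, y].
Proof. by have := lie_linearl y k x 0; rewrite /= lie0l !addr0. Qed.

Lemma lieZr k x y : [lie x, k *: y] = k *: [lie x, y].
Proof. exact: linearZ. Qed.

Lemma lieNl x y : [lie - x, y] = - [lie x, y].
Proof. by rewrite -!scaleN1r lieZl. Qed.

Lemma lieNr x y : [lie x, - y] = - [lie x, y].
Proof. exact: linearN. Qed.

Lemma lieC x y : [lie x, y] = - [lie y, x].
Proof.
apply/eqP; rewrite -addr_eq0; apply/eqP.
have := liexx (x + y); rewrite lieDl !linearD /= !liexx.
by rewrite add0r addr0.
Qed.

Lemma lie_ad x y z : [lie [lie x, y], z] = [lie x, [lie y, z]] - [lie y, [lie x, z]].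
Proof.
have := lie_jacobi x y z; rewrite (lieC z [lie x, y]) (lieC z x) linearN /=.
by move/eqP; rewrite subr_eq0 => /eqP <-.
Qed.

Lemma lie_tliftl (U V : vectType K) (b : U -> V -> g) t z :
  [lie tlift b t, z] = tlift (fun u v => [lie b u v, z]) t.
Proof.
pose L : {linear g -> g} :=
  HB.pack (lie^~ z) (GRing.isLinear.Build K g g _ (lie^~ z) (lie_linearl z)).
exact: (linear_tlift L).
Qed.

End LieTheory.

Definition lie_hom (K : fieldType) (g h : lieAlgType K) (phi : 'Hom(g, h)) :=
  forall x y, phi [lie x, y] = [lie phi x, phi y].

Record representation (K : fieldType) (g : lieAlgType K) (V : vectType K) :=
  Representation {
    rep_fun :> g -> 'End(V);
    rep_linear : linear rep_fun;
    rep_lie : forall x y,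
      rep_fun [lie x, y]
      = (rep_fun x \o rep_fun y)%VF - (rep_fun y \o rep_fun x)%VF
  }.

Section Representations.
Variables (K : fieldType) (g : lieAlgType K).

Fact ad_linear : linear (@ad K g).
Proof.
move=> k x y; apply/lfunP => z; rewrite add_lfunE scale_lfunE !adE.
exact: lie_linearl.
Qed.

Fact ad_lie (x y : g) : ad [lie x, y] = (ad x \o ad y)%VF - (ad y \o ad x)%VF.
Proof.
apply/lfunP => z; rewrite add_lfunE opp_lfunE !comp_lfunE !adE.
exact: lie_ad.
Qed.

Definition ad_rep : representation g g := Representation ad_linear ad_lie.

Variables (V : vectType K) (rho : representation g V).

Definition dual_rep_fun (x : g) : 'End(dual V) := - transpose (rho x).

Fact dual_rep_linear : linear dual_rep_fun.
Proof.
move=> k x y; apply/lfunP => a; rewrite add_lfunE scale_lfunE.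
apply/dualP => v; rewrite pairingDl pairingZl /dual_rep_fun !opp_lfunE !pairingNl.
rewrite !pairing_transpose rep_linear add_lfunE scale_lfunE pairingDr pairingZr.
by rewrite opprD mulrN.
Qed.

Fact dual_rep_lie x y :
  dual_rep_fun [lie x, y]
  = (dual_rep_fun x \o dual_rep_fun y)%VF - (dual_rep_fun y \o dual_rep_fun x)%VF.
Proof.
apply/lfunP => a; rewrite add_lfunE opp_lfunE !comp_lfunE /dual_rep_fun !opp_lfunE.
apply/dualP => v; rewrite pairingDl !pairingNl !pairing_transpose !pairingNl.
rewrite !pairing_transpose rep_lie add_lfunE opp_lfunE !comp_lfunE.
by rewrite pairingDr pairingNr !opprK opprD opprK addrC.
Qed.

Definition dual_rep : representation g (dual V) :=
  Representation dual_rep_linear dual_rep_lie.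

End Representations.

Definition coad (K : fieldType) (g : lieAlgType K) : representation g (dual g) :=
  dual_rep (ad_rep g).

Lemma pairing_coad (K : fieldType) (g : lieAlgType K) (x y : g) (a : dual g) :
  pairing (coad g x a) y = - pairing a [lie x, y].
Proof.
by rewrite /= /dual_rep_fun opp_lfunE pairingNl pairing_transpose adE.
Qed.

Definition O_operator (K : fieldType) (g : lieAlgType K) (V : vectType K)
    (rho : representation g V) (T : 'Hom(V, g)) :=
  forall u v, [lie T u, T v] = T (rho (T u) v - rho (T v) u).

Definition O_operator_hom (K : fieldType) (g h : lieAlgType K)
    (Vg Vh : vectType K)
    (rhog : representation g Vg) (Tg : 'Hom(Vg, g))
    (rhoh : representation h Vh) (Th : 'Hom(Vh, h))
    (phi : 'Hom(g, h)) (alpha : 'Hom(Vg, Vh)) :=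
  [/\ lie_hom phi,
      forall x v, alpha (rhog x v) = rhoh (phi x) (alpha v)
    & (Th \o alpha)%VF = (phi \o Tg)%VF].

Section RMatrix.
Variables (K : fieldType) (g : lieAlgType K).
Implicit Type r : tensor g g.

(* g (x) g (x) g is tensor g (tensor g g) *)
Definition cybe12_13 r : tensor g (tensor g g) :=
  tlift (fun a b => tlift (fun a' b' => tens [lie a, a'] (tens b b')) r) r.

Definition cybe13_23 r : tensor g (tensor g g) :=
  tlift (fun a b => tlift (fun a' b' => tens a (tens a' [lie b, b'])) r) r.

Definition cybe12_23 r : tensor g (tensor g g) :=
  tlift (fun a b => tlift (fun a' b' => tens a (tens [lie b, a'] b')) r) r.

Definition r_matrix r := cybe12_13 r + cybe13_23 r + cybe12_23 r = 0.

Definition skew_symmetric r := r = - flip r.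

Definition ad_invariant (s : tensor g g) :=
  forall x : g, tmap (ad x) id s + tmap id (ad x) s = 0.

Definition sharp_fun r (a : dual g) : g := tlift (fun x y => pairing a x *: y) r.

Fact sharp_fun_is_linear r : linear (sharp_fun r).
Proof.
move=> k a b; rewrite /sharp_fun /tlift scaler_sumr -big_split.
apply: eq_bigr => i _; rewrite scaler_sumr -big_split; apply: eq_bigr => j _ /=.
by rewrite pairingDl pairingZl scalerDl scalerDr !scalerA mulrCA mulrA.
Qed.

HB.instance Definition _ r :=
  GRing.isLinear.Build K (dual g) g _ (sharp_fun r) (sharp_fun_is_linear r).

Definition sharp r : 'Hom(dual g, g) := linfun (sharp_fun r).

Lemma sharpE r a : sharp r a = tlift (fun x y => pairing a x *: y) r.
Proof. exact: lfunE. Qed.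

Definition skew_operator (T : 'Hom(dual g, g)) :=
  forall a b : dual g, pairing b (T a) + pairing a (T b) = 0.

Lemma pairing_sharp r a b :
  pairing b (sharp r a)
  = tlift (fun x y => pairing a x * pairing b y : K^o) r.
Proof.
rewrite sharpE (linear_tlift (pairing b : g -> K^o)).
by apply: (@eq_tlift K g g K^o) => x y /=; rewrite pairingZr.
Qed.

Lemma skew_sharp r : skew_symmetric r -> skew_operator (sharp r).
Proof.
move=> skew_r a b; rewrite !pairing_sharp {1}skew_r linearN /=.
rewrite tlift_flip => [|v k u u'|u k v v'].
- set t := tlift _ r; set s := tlift _ r; suff -> : s = t by exact: addNr.
  by apply: eq_tlift => x y; exact: mulrC.
- by rewrite pairingDr pairingZr mulrDl -mulrA.
by rewrite pairingDr pairingZr mulrDr mulrCA.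
Qed.

(* The functional a (x) b (x) c on g (x) g (x) g *)
Definition eval3 (a b c : dual g) (t : tensor g (tensor g g)) : K^o :=
  tlift (fun x (s : tensor g g) => pairing a x *: (tlift (fun y z =>
    pairing b y * pairing c z : K^o) s)) t.

Lemma eval3E a b c x y z :
  eval3 a b c (tens x (tens y z)) = pairing a x * (pairing b y * pairing c z).
Proof.
rewrite /eval3 tliftE.
- rewrite tliftE // => [v k u u'|u k v v'] /=.
    by rewrite pairingDr pairingZr mulrDl -mulrA.
  by rewrite pairingDr pairingZr mulrDr mulrCA.
- by move=> s k u u'; rewrite pairingDr pairingZr scalerDl scalerA.
- by move=> u k s s'; rewrite linearP scalerDr !scalerA mulrC.
Qed.

Lemma skew_sharp_left r b : skew_symmetric r ->
  tlift (fun x y => pairing b y *: x) r = - sharp r b.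
Proof.
move=> skew_r; apply/pairing_sep => a; rewrite pairingNr.
have /eqP := skew_sharp skew_r a b; rewrite addr_eq0 => /eqP <-.
rewrite pairing_sharp (linear_tlift (pairing a : g -> K^o)).
by apply: (@eq_tlift K g g K^o) => x y /=; rewrite pairingZr mulrC.
Qed.

Lemma r_matrix_sharp r :
  skew_symmetric r -> r_matrix r -> O_operator (coad g) (sharp r).
Proof.
move=> skew_r cybe_r a b; apply/pairing_sep => c.
have skT := skew_sharp skew_r.
have L (w : dual g) (f h : g -> g -> g) :
    pairing w [lie tlift f r, tlift h r]
    = tlift (fun x y => tlift (fun x' y' =>
        pairing w [lie f x y, h x' y'] : K^o) r) r.
  rewrite lie_tliftl (linear_tlift (pairing w : g -> K^o)); apply: (@eq_tlift K g g K^o) => x y.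
  rewrite (linear_tlift (lie _)) (linear_tlift (pairing w : g -> K^o)).
  exact: (@eq_tlift K g g K^o).
pose E : {linear tensor g (tensor g g) -> K^o} := HB.pack (eval3 a b c)
  (GRing.isLinear.Build K _ K^o _ (eval3 a b c) (tlift_is_linear _)).
have E12 : E (cybe12_13 r) = pairing a [lie sharp r b, sharp r c].
  rewrite -[sharp r b]opprK -[sharp r c]opprK -!skew_sharp_left //.
  rewrite lieNl lieNr opprK L.
  rewrite (linear_tlift E); apply: (@eq_tlift K g g K^o) => x y.
  rewrite (linear_tlift E); apply: (@eq_tlift K g g K^o) => x' y' /=.
  by rewrite eval3E lieZl lieZr !pairingZr mulrC -mulrA.
have E13 : E (cybe13_23 r) = pairing c [lie sharp r a, sharp r b].
  rewrite !sharpE L.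
  rewrite (linear_tlift E); apply: (@eq_tlift K g g K^o) => x y.
  rewrite (linear_tlift E); apply: (@eq_tlift K g g K^o) => x' y' /=.
  by rewrite eval3E lieZl lieZr !pairingZr.
have E23 : E (cybe12_23 r) = - pairing b [lie sharp r a, sharp r c].
  rewrite -[sharp r c]opprK -skew_sharp_left // lieNr pairingNr opprK.
  rewrite sharpE L.
  rewrite (linear_tlift E); apply: (@eq_tlift K g g K^o) => x y.
  rewrite (linear_tlift E); apply: (@eq_tlift K g g K^o) => x' y' /=.
  by rewrite eval3E lieZl lieZr !pairingZr [pairing b _ * _]mulrC.
have /eqP : E (cybe12_13 r + cybe13_23 r + cybe12_23 r) = 0.
  by rewrite cybe_r linear0.
rewrite linearD linearD E12 E13 E23 subr_eq0 => /eqP Er.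
have skc d : pairing c (sharp r d) = - pairing d (sharp r c).
  by apply/eqP; rewrite -addr_eq0 skT.
rewrite skc pairingDl pairingNl !pairing_coad opprD !opprK -Er.
by rewrite addrAC subrr add0r.
Qed.

End RMatrix.

Definition coherent_hom (K : fieldType) (g h : lieAlgType K)
    (rg : tensor g g) (rh : tensor h h) (phi : 'Hom(g, h)) (psi : 'Hom(h, g)) :=
  [/\ lie_hom phi,
      tmap psi id rh = tmap id phi rg,
      tmap id psi rh = tmap phi id rg
    & forall x y, psi [lie phi x, y] = [lie x, psi y]].

Record category := Category {
  obj :> Type;
  mor : obj -> obj -> Type;
  idm : forall X, mor X X;
  compm : forall X Y Z, mor Y Z -> mor X Y -> mor X Z;
  compm_idl : forall X Y (f : mor X Y), compm (idm Y) f = f;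
  compm_idr : forall X Y (f : mor X Y), compm f (idm X) = f;
  compmA : forall X Y Z W (h : mor Z W) (g : mor Y Z) (f : mor X Y),
    compm h (compm g f) = compm (compm h g) f
}.
Arguments mor {c} X Y.
Arguments idm {c} X.
Arguments compm {c X Y Z} g f.

(* The full subcategory of C spanned by the objects iota i. *)
Definition full_subcategory (C : category) (I : Type) (iota : I -> C) : category :=
  @Category I (fun i j => mor (iota i) (iota j)) (fun i => idm (iota i))
    (fun i j k g f => compm g f)
    (fun i j f => compm_idl f) (fun i j f => compm_idr f)
    (fun i j k l h g f => compmA h g f).

Definition preserves_id (C D : category) (F0 : C -> D)
    (F1 : forall X Y, mor X Y -> mor (F0 X) (F0 Y)) :=
  forall X, F1 X X (idm X) = idm (F0 X).

Definition preserves_comp (C D : category) (F0 : C -> D)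
    (F1 : forall X Y, mor X Y -> mor (F0 X) (F0 Y)) :=
  forall X Y Z (g : mor Y Z) (f : mor X Y),
    F1 X Z (compm g f) = compm (F1 Y Z g) (F1 X Y f).

Record functor (C D : category) := Functor {
  fobj :> C -> D;
  fmap : forall X Y, mor X Y -> mor (fobj X) (fobj Y);
  fmap_id : preserves_id fmap;
  fmap_comp : preserves_comp fmap
}.
Arguments fmap {C D} f {X Y}.

Definition id_functor (C : category) : functor C C :=
  @Functor C C id (fun _ _ f => f) (fun _ => erefl) (fun _ _ _ _ _ => erefl).

Section CompFunctor.
Variables (C D E : category) (G : functor D E) (F : functor C D).

Fact comp_functor_id : preserves_id (fun X Y (f : mor X Y) => fmap G (fmap F f)).
Proof. by move=> X; rewrite !fmap_id. Qed.

Fact comp_functor_comp :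
  preserves_comp (fun X Y (f : mor X Y) => fmap G (fmap F f)).
Proof. by move=> X Y Z g f; rewrite !fmap_comp. Qed.

Definition comp_functor : functor C E :=
  Functor comp_functor_id comp_functor_comp.

End CompFunctor.

Definition is_isom (C : category) (X Y : C) (f : mor X Y) :=
  exists f' : mor Y X, compm f' f = idm X /\ compm f f' = idm Y.

Definition naturally_isomorphic (C D : category) (F G : functor C D) :=
  exists eta : forall X, mor (F X) (G X),
    (forall X Y (f : mor X Y), compm (eta Y) (fmap F f) = compm (fmap G f) (eta X))
    /\ (forall X, is_isom (eta X)).

Definition is_equivalence (C D : category) (F : functor C D) :=
  exists G : functor D C,
    naturally_isomorphic (comp_functor G F) (id_functor C)
    /\ naturally_isomorphic (comp_functor F G) (id_functor D).

Section RMatrixCategory.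
Variable K : fieldType.

(* Classical r-matrices r with ad-invariant symmetric part r + tau(r) *)
Record cr_obj := CrObj {
  cr_alg : lieAlgType K;
  cr_tensor : tensor cr_alg cr_alg;
  cr_r_matrix : r_matrix cr_tensor;
  cr_invariant : ad_invariant (cr_tensor + flip cr_tensor)
}.

Record cr_hom (X Y : cr_obj) := CrHom {
  cr_phi : 'Hom(cr_alg X, cr_alg Y);
  cr_psi : 'Hom(cr_alg Y, cr_alg X);
  cr_homP : coherent_hom (cr_tensor X) (cr_tensor Y) cr_phi cr_psi
}.

Lemma cr_hom_eq X Y (f g : cr_hom X Y) :
  cr_phi f = cr_phi g -> cr_psi f = cr_psi g -> f = g.
Proof.
case: f g => [p s H] [p' s' H'] /= ep es; case: p' / ep H' => H'.
by case: s' / es H' => H'; rewrite (boolp.Prop_irrelevance H H').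
Qed.

Fact cr_id_subproof (X : cr_obj) :
  coherent_hom (cr_tensor X) (cr_tensor X) \1%VF \1%VF.
Proof.
have id1 : (\1%VF : 'End(cr_alg X)) =1 id by move=> x; rewrite id_lfunE.
split=> [x y|||x y]; rewrite ?id_lfunE //; exact: eq_tmap.
Qed.

Definition cr_id X : cr_hom X X := CrHom (cr_id_subproof X).

Fact cr_comp_subproof X Y Z (g : cr_hom Y Z) (f : cr_hom X Y) :
  coherent_hom (cr_tensor X) (cr_tensor Z)
    (cr_phi g \o cr_phi f)%VF (cr_psi f \o cr_psi g)%VF.
Proof.
case: g f => [p2 s2 [h2 a2 b2 c2]] [p1 s1 [h1 a1 b1 c1]] /=.
have lin_id (V : vectType K) : linear (id : V -> V) by [].
split=> [x y|||x y].
- by rewrite !comp_lfunE h1 h2.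
- transitivity (tmap s1 p2 (cr_tensor Y)).
    transitivity (tmap s1 id (tmap s2 id (cr_tensor Z))).
      by rewrite tmap_comp //; [apply: eq_tmap => x; rewrite ?comp_lfunE | exact: linearP].
    by rewrite a2 tmap_comp //; exact: linearP.
  transitivity (tmap id p2 (tmap id p1 (cr_tensor X))).
    by rewrite -a1 tmap_comp //; exact: linearP.
  by rewrite tmap_comp //; [apply: eq_tmap => x; rewrite ?comp_lfunE | exact: linearP].
- transitivity (tmap p2 s1 (cr_tensor Y)).
    transitivity (tmap id s1 (tmap id s2 (cr_tensor Z))).
      by rewrite tmap_comp //; [apply: eq_tmap => x; rewrite ?comp_lfunE | exact: linearP].
    by rewrite b2 tmap_comp //; exact: linearP.
  transitivity (tmap p2 id (tmap p1 id (cr_tensor X))).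
    by rewrite -b1 tmap_comp //; exact: linearP.
  by rewrite tmap_comp //; [apply: eq_tmap => x; rewrite ?comp_lfunE | exact: linearP].
- by rewrite !comp_lfunE c2 c1.
Qed.

Definition cr_comp X Y Z (g : cr_hom Y Z) (f : cr_hom X Y) : cr_hom X Z :=
  CrHom (cr_comp_subproof g f).

Fact cr_comp_idl X Y (f : cr_hom X Y) : cr_comp (cr_id Y) f = f.
Proof. by apply: cr_hom_eq; rewrite /= ?comp_lfun1l ?comp_lfun1r. Qed.

Fact cr_comp_idr X Y (f : cr_hom X Y) : cr_comp f (cr_id X) = f.
Proof. by apply: cr_hom_eq; rewrite /= ?comp_lfun1l ?comp_lfun1r. Qed.

Fact cr_compA X Y Z W (h : cr_hom Z W) (g : cr_hom Y Z) (f : cr_hom X Y) :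
  cr_comp h (cr_comp g f) = cr_comp (cr_comp h g) f.
Proof. by apply: cr_hom_eq; rewrite /= comp_lfunA. Qed.

Definition Cr : category := Category cr_comp_idl cr_comp_idr cr_compA.

Definition scr_obj := {X : Cr | skew_symmetric (cr_tensor X)}.

Definition SCr : category := @full_subcategory Cr scr_obj sval.

End RMatrixCategory.

Section OOperatorCategory.
Variable K : fieldType.

Record op_obj := OpObj {
  op_alg : lieAlgType K;
  op_mod : vectType K;
  op_rep : representation op_alg op_mod;
  op_map : 'Hom(op_mod, op_alg);
  op_O_operator : O_operator op_rep op_map
}.

Record op_hom (X Y : op_obj) := OpHom {
  op_phi : 'Hom(op_alg X, op_alg Y);
  op_alpha : 'Hom(op_mod X, op_mod Y);
  op_homP : O_operator_hom (op_rep X) (op_map X) (op_rep Y) (op_map Y)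
    op_phi op_alpha
}.

Lemma op_hom_eq X Y (f g : op_hom X Y) :
  op_phi f = op_phi g -> op_alpha f = op_alpha g -> f = g.
Proof.
case: f g => [p s H] [p' s' H'] /= ep es; case: p' / ep H' => H'.
by case: s' / es H' => H'; rewrite (boolp.Prop_irrelevance H H').
Qed.

Fact op_id_subproof (X : op_obj) :
  O_operator_hom (op_rep X) (op_map X) (op_rep X) (op_map X) \1%VF \1%VF.
Proof. by split=> [x y|x v|]; rewrite ?id_lfunE // comp_lfun1l comp_lfun1r. Qed.

Definition op_id X : op_hom X X := OpHom (op_id_subproof X).

Fact op_comp_subproof X Y Z (g : op_hom Y Z) (f : op_hom X Y) :
  O_operator_hom (op_rep X) (op_map X) (op_rep Z) (op_map Z)
    (op_phi g \o op_phi f)%VF (op_alpha g \o op_alpha f)%VF.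
Proof.
case: g f => [p2 a2 [h2 e2 c2]] [p1 a1 [h1 e1 c1]] /=.
split=> [x y|x v|]; first by rewrite !comp_lfunE h1 h2.
  by rewrite !comp_lfunE e1 e2.
by rewrite comp_lfunA c2 -comp_lfunA c1 comp_lfunA.
Qed.

Definition op_comp X Y Z (g : op_hom Y Z) (f : op_hom X Y) : op_hom X Z :=
  OpHom (op_comp_subproof g f).

Fact op_comp_idl X Y (f : op_hom X Y) : op_comp (op_id Y) f = f.
Proof. by apply: op_hom_eq; rewrite /= comp_lfun1l. Qed.

Fact op_comp_idr X Y (f : op_hom X Y) : op_comp f (op_id X) = f.
Proof. by apply: op_hom_eq; rewrite /= comp_lfun1r. Qed.

Fact op_compA X Y Z W (h : op_hom Z W) (g : op_hom Y Z) (f : op_hom X Y) :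
  op_comp h (op_comp g f) = op_comp (op_comp h g) f.
Proof. by apply: op_hom_eq; rewrite /= comp_lfunA. Qed.

Definition OP : category := Category op_comp_idl op_comp_idr op_compA.

Record sop_obj := SopObj {
  sop_alg : lieAlgType K;
  sop_map : 'Hom(dual sop_alg, sop_alg);
  sop_O_operator : O_operator (coad sop_alg) sop_map;
  sop_skew : skew_operator sop_map
}.

Definition op_of_sop (X : sop_obj) : OP := OpObj (@sop_O_operator X).

Definition SOPcoad : category := full_subcategory op_of_sop.

Definition sharp_obj (X : SCr K) : SOPcoad :=
  SopObj (r_matrix_sharp (svalP X) (cr_r_matrix (sval X))) (skew_sharp (svalP X)).

End OOperatorCategory.

(* Main.v *)
(* Contracting the first leg of a tensor t in U (x) V gives a map U^* -> V,
   and t is recovered as sum_i e_i (x) t(e^i) in dual bases; hence r |-> r^sharp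
   is a bijection from tensors to operators. Pairing the defining equations with
   covectors turns each coherence condition on (phi, psi) into an intertwining
   condition on (phi, psi^T), the two tensor conditions being the same one
   because r is skew. In the same way CYBE paired with a (x) b (x) c is the
   O-operator identity paired with c, so the inverse of sharp takes skew
   O-operators to r-matrices and, together with inverse transposition on
   morphisms, is a quasi-inverse. *)
Require Import Defs.
From HB Require Import structures.
From mathcomp Require Import all_boot all_order all_algebra.

Set Implicit Arguments.
Unset Strict Implicit.
Unset Printing Implicit Defensive.

Import GRing.Theory.
Local Open Scope ring_scope.

(** * Dual bases and coordinates of covectors *)

Section DualBasis.
Variables (K : fieldType) (V : vectType K).

Definition dual_vbasis (i : 'I_(\dim {:V})) : dual V :=
  linfun (coord (vbasis {:V}) i : V -> K^o).

Lemma pairing_dual_vbasis i v :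
  pairing (dual_vbasis i) v = coord (vbasis {:V}) i v.
Proof. by rewrite /pairing lfunE. Qed.

Lemma pairing_suml (I : Type) (s : seq I) (F : I -> dual V) v :
  pairing (\sum_(i <- s) F i) v = \sum_(i <- s) pairing (F i) v.
Proof. exact: (sum_lfunE s xpredT (F : I -> 'Hom(V, K^o))). Qed.

Lemma dual_vbasis_expansion (a : dual V) :
  a = \sum_(i < \dim {:V}) pairing a (vbasis {:V})`_i *: dual_vbasis i.
Proof.
apply/dualP => v.
rewrite pairing_suml {1}(coord_vbasis (memvf v)) linear_sum.
by apply: eq_bigr => i _; rewrite pairingZl pairing_dual_vbasis linearZ mulrC.
Qed.

End DualBasis.

(** * Transposition as a bijection between spaces of linear maps *)

Section TransposeBijection.
Variables (K : fieldType) (U V : vectType K).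

Lemma transpose_inj : injective (@transpose K U V).
Proof.
move=> f f' eq_ff'; apply/lfunP => u; apply/pairing_sep => a.
by rewrite -!pairing_transpose eq_ff'.
Qed.

(** The coordinates are forced: if [f] is the transpose of [k], the [i]-th coordinate of [k u] is
    the pairing of [f (dual_vbasis i)] with [u]. *)
Definition untranspose_fun (f : 'Hom(dual V, dual U)) (u : U) : V :=
  \sum_i pairing (f (dual_vbasis i)) u *: (vbasis {:V})`_i.

Fact untranspose_fun_is_linear f : linear (untranspose_fun f).
Proof.
move=> k u v; rewrite /untranspose_fun scaler_sumr -big_split.
by apply: eq_bigr => i _; rewrite pairingDr pairingZr scalerDl scalerA.
Qed.

HB.instance Definition _ f :=
  GRing.isLinear.Build K U V _ (untranspose_fun f) (untranspose_fun_is_linear f).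

Definition untranspose f : 'Hom(U, V) := linfun (untranspose_fun f).

Lemma untransposeK : cancel untranspose (@transpose K U V).
Proof.
move=> f; apply/lfunP => a; apply/dualP => u.
rewrite pairing_transpose lfunE /= linear_sum {2}(dual_vbasis_expansion a).
rewrite linear_sum pairing_suml.
by apply: eq_bigr => i _; rewrite !linearZ /= pairingZl mulrC.
Qed.

Lemma transposeK : cancel (@transpose K U V) untranspose.
Proof. by move=> f; apply: transpose_inj; rewrite untransposeK. Qed.

End TransposeBijection.

Lemma transpose1 (K : fieldType) (V : vectType K) :
  transpose (\1%VF : 'End(V)) = \1%VF.
Proof.
by apply/lfunP => a; apply/dualP => v; rewrite pairing_transpose !id_lfunE.
Qed.

Lemma transpose_comp (K : fieldType) (U V W : vectType K)
    (f : 'Hom(V, W)) (g : 'Hom(U, V)) :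
  transpose (f \o g)%VF = (transpose g \o transpose f)%VF.
Proof.
apply/lfunP => a; apply/dualP => u.
by rewrite comp_lfunE !pairing_transpose comp_lfunE.
Qed.

(** * Tensors as linear maps out of a dual space *)

Section Contraction.
Variables (K : fieldType) (U V : vectType K).

(** This extends [sharp_fun] to two different spaces, so that it also covers mixed tensors on [g]
    and [h] and triple tensors, whose second leg is itself a tensor product. *)
Definition contract (t : tensor U V) (a : dual U) : V :=
  tlift (fun x y => pairing a x *: y) t.

HB.instance Definition _ u :=
  GRing.isLinear.Build K V (tensor U V) _ (tens u) (@tens_linearr K U V u).

Lemma tens_suml (I : Type) (s : seq I) (F : I -> U) (v : V) :
  tens (\sum_(i <- s) F i) v = \sum_(i <- s) tens (F i) v.
Proof.
pose f (u : U) := tens u v; have linf : linear f := @tens_linearl K U V v.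
pose L : {linear U -> tensor U V} :=
  HB.pack f (GRing.isLinear.Build K U (tensor U V) _ f linf).
exact: (linear_sum L).
Qed.

Lemma tensZl k (u : U) (v : V) : tens (k *: u) v = tens u (k *: v).
Proof. by apply/matrixP => i j; rewrite !mxE !linearZ /= mulrCA mulrA. Qed.

Lemma contract_expansion (t : tensor U V) :
  t = \sum_(i < \dim {:U}) tens (vbasis {:U})`_i (contract t (dual_vbasis i)).
Proof.
under eq_bigr => i _ do rewrite /contract (linear_tlift (tens _)).
(* Exchanging the sums puts the coefficients of [t] outermost, which leaves the claim for a single
   pair of basis vectors. *)
rewrite [LHS]tensE /tlift [RHS]exchange_big; apply: eq_bigr => i _.
rewrite [RHS]exchange_big; apply: eq_bigr => j _; rewrite -scaler_sumr.
congr (_ *: _); set u := _`_i; set v := _`_j.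
rewrite {1}(coord_vbasis (memvf u)) tens_suml; apply: eq_bigr => k _ /=.
by rewrite pairing_dual_vbasis tensZl.
Qed.

Lemma contract_inj (s t : tensor U V) : contract s =1 contract t -> s = t.
Proof.
move=> eq_st; rewrite (contract_expansion s) (contract_expansion t).
by apply: eq_bigr => i _; rewrite eq_st.
Qed.

Lemma pairing_contract (t : tensor U V) a b :
  pairing b (contract t a) = tlift (fun x y => pairing a x * pairing b y : K^o) t.
Proof.
rewrite /contract (linear_tlift (pairing b : V -> K^o)).
by apply: (@eq_tlift K U V K^o) => x y /=; rewrite pairingZr.
Qed.

End Contraction.

(** Pairing [a] with [f x] moves [f] onto [a]; this is how the transpose of [psi] enters. *)
Lemma contract_tmap (K : fieldType) (U U' V V' : vectType K)
    (f : 'Hom(U, U')) (g : 'Hom(V, V')) (t : tensor U V) (a : dual U') :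
  contract (tmap f g t) a = g (contract t (transpose f a)).
Proof.
rewrite /contract /tmap (linear_tlift (tlift _)) linear_tlift.
apply: eq_tlift => u v /=; rewrite tliftE => [|y k x x'|x k y y'].
- by rewrite linearZ pairing_transpose.
- by rewrite pairingDr pairingZr scalerDl scalerA.
by rewrite scalerDr !scalerA mulrC.
Qed.

(** Coherence is stated with the bare function [id], whereas [contract_tmap] takes elements of
    ['Hom]. *)
Lemma tmap_idl (K : fieldType) (U V V' : vectType K) (g : 'Hom(V, V')) :
  tmap id g =1 tmap (\1%VF : 'End(U)) g.
Proof. by apply: eq_tmap => // u; rewrite id_lfunE. Qed.

Lemma tmap_idr (K : fieldType) (U U' V : vectType K) (f : 'Hom(U, U')) :
  tmap f id =1 tmap f (\1%VF : 'End(V)).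
Proof. by apply: eq_tmap => // v; rewrite id_lfunE. Qed.

(** * The inverse of [sharp], and CYBE against the O-operator identity *)

Section SharpInverse.
Variables (K : fieldType) (g : lieAlgType K).
Implicit Types (r : tensor g g) (T : 'Hom(dual g, g)).

(** The right-hand side of [contract_expansion], with [T] in place of the contraction. *)
Definition sharp_inv T : tensor g g :=
  \sum_(i < \dim {:g}) tens (vbasis {:g})`_i (T (dual_vbasis i)).

Lemma sharp_contract r a : sharp r a = contract r a.
Proof. exact: sharpE. Qed.

Lemma sharpK : cancel (@sharp K g) sharp_inv.
Proof.
move=> r; rewrite [RHS]contract_expansion.
by apply: eq_bigr => i _; rewrite sharp_contract.
Qed.

Lemma sharp_invK : cancel sharp_inv (@sharp K g).
Proof.
move=> T; apply/lfunP => a; rewrite sharpE linear_sum.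
rewrite {2}(dual_vbasis_expansion a) linear_sum; apply: eq_bigr => i _.
rewrite linearZ /= tliftE // => [y k x x'|x k y y'].
  by rewrite pairingDr pairingZr scalerDl scalerA.
by rewrite scalerDr !scalerA mulrC.
Qed.

Lemma skew_pairing T a b :
  skew_operator T -> pairing b (T a) = - pairing a (T b).
Proof. by move=> skT; apply/eqP; rewrite -addr_eq0 skT. Qed.

Lemma contract_flip r a b :
  pairing b (contract (flip r) a) = pairing a (contract r b).
Proof.
rewrite !pairing_contract tlift_flip => [|y k x x'|x k y y'].
- by apply: (@eq_tlift K g g K^o) => x y; exact: mulrC.
- by rewrite pairingDr pairingZr mulrDl -mulrA.
by rewrite pairingDr pairingZr mulrDr mulrCA.
Qed.

Lemma skew_sharp_inv T : skew_operator T -> skew_symmetric (sharp_inv T).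
Proof.
move=> skT; apply: contract_inj => a; apply/pairing_sep => b.
(* For fixed [a], contraction is a [tlift], hence linear in the tensor. *)
have -> : contract (- flip (sharp_inv T)) a = - contract (flip (sharp_inv T)) a.
  exact: linearN.
rewrite pairingNr contract_flip -!sharp_contract sharp_invK.
exact: skew_pairing.
Qed.

Lemma eval3_contract (a b c : dual g) t :
  eval3 a b c t = pairing c (contract (contract t a) b).
Proof.
rewrite pairing_contract /contract (linear_tlift (tlift _)).
by apply: (@eq_tlift K g _ K^o) => x s; rewrite linearZ.
Qed.

Lemma eval3_inj (s t : tensor g (tensor g g)) :
  (forall a b c, eval3 a b c s = eval3 a b c t) -> s = t.
Proof.
move=> eq_st; apply: contract_inj => a; apply: contract_inj => b.
by apply/pairing_sep => c; rewrite -!eval3_contract.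
Qed.

(** In each CYBE term one leg carries the bracket, and the other two covectors contract the two
    copies of [r]. Contracting a second leg gives minus [sharp] by skewness: this happens twice in
    the first term, never in the second, once in the third. *)
Lemma eval3_cybe r (a b c : dual g) : skew_symmetric r ->
  eval3 a b c (cybe12_13 r + cybe13_23 r + cybe12_23 r)
  = pairing a [lie sharp r b, sharp r c] + pairing c [lie sharp r a, sharp r b]
    - pairing b [lie sharp r a, sharp r c].
Proof.
move=> skew_r.
have L (w : dual g) (f h : g -> g -> g) :
    pairing w [lie tlift f r, tlift h r]
    = tlift (fun x y => tlift (fun x' y' =>
        pairing w [lie f x y, h x' y'] : K^o) r) r.
  rewrite lie_tliftl (linear_tlift (pairing w : g -> K^o)).
  apply: (@eq_tlift K g g K^o) => x y.
  rewrite (linear_tlift (lie _)) (linear_tlift (pairing w : g -> K^o)).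
  exact: (@eq_tlift K g g K^o).
pose E : {linear tensor g (tensor g g) -> K^o} := HB.pack (eval3 a b c)
  (GRing.isLinear.Build K _ K^o _ (eval3 a b c) (tlift_is_linear _)).
have EE f : E (tlift (fun x y => tlift (f x y) r) r)
    = tlift (fun x y => tlift (fun x' y' => E (f x y x' y')) r) r.
  rewrite (linear_tlift E); apply: (@eq_tlift K g g K^o) => x y.
  exact: (linear_tlift E).
rewrite -[LHS]/(E _) 2!linearD /cybe12_13 /cybe13_23 /cybe12_23 !EE.
(* [b] contracts a second leg only in the first term, hence the single occurrence; [c] does so
   wherever [sharp r c] appears. *)
rewrite -{1}[sharp r b]opprK -[sharp r c]opprK -!skew_sharp_left //.
rewrite !(lieNl, lieNr, pairingNr) !opprK !sharpE !L.
congr (_ + _ + _); apply: (@eq_tlift K g g K^o) => x y;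
  apply: (@eq_tlift K g g K^o) => x' y' /=;
  rewrite eval3E lieZl lieZr !pairingZr.
- by rewrite mulrC -mulrA.
- by [].
by rewrite [pairing b _ * _]mulrC.
Qed.

(** By the O-operator identity and skewness, the term paired with [c] becomes minus the pairing of
    [sharp r c] with a difference of coadjoint actions; unfolding [coad] cancels the other two
    terms. *)
Lemma O_operator_r_matrix r :
  skew_symmetric r -> O_operator (coad g) (sharp r) -> r_matrix r.
Proof.
move=> skew_r Or; apply: eval3_inj => a b c.
rewrite eval3_cybe // (Or a b) (skew_pairing _ _ (skew_sharp skew_r)).
rewrite pairingDl pairingNl !pairing_coad !opprD !opprK.
have -> : eval3 a b c 0 = 0 by rewrite eval3_contract /contract !linear0.
by rewrite addrCA subrr addr0 subrr.
Qed.

End SharpInverse.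

(** * Coherence conditions as intertwining conditions *)

Section CoherentHom.
Variables (K : fieldType) (g h : lieAlgType K).
Variables (rg : tensor g g) (rh : tensor h h).
Variables (phi : 'Hom(g, h)) (psi : 'Hom(h, g)).

(** Contracting the first leg with a covector of [g] turns each side of one equation into the
    matching side of the other; injectivity of contraction gives the way back. *)
Lemma intertwining_tmapl :
  (sharp rh \o transpose psi)%VF = (phi \o sharp rg)%VF
  <-> tmap psi id rh = tmap id phi rg.
Proof.
rewrite tmap_idl tmap_idr; split=> [eqT | eqr].
- apply: contract_inj => a; rewrite !contract_tmap transpose1 !id_lfunE.
  by rewrite -!sharp_contract -!comp_lfunE eqT.
apply/lfunP => a; rewrite !comp_lfunE !sharp_contract.
have := congr1 ((@contract K g h)^~ a) eqr.
by rewrite /= !contract_tmap transpose1 !id_lfunE.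
Qed.

(** Here the first leg lies in [h]. Skewness of both tensors exchanges the two covectors, and the
    two signs cancel. *)
Lemma intertwining_tmapr : skew_symmetric rg -> skew_symmetric rh ->
  (sharp rh \o transpose psi)%VF = (phi \o sharp rg)%VF ->
  tmap id psi rh = tmap phi id rg.
Proof.
move=> /skew_sharp skg /skew_sharp skh eqT; rewrite tmap_idl tmap_idr.
apply: contract_inj => b; rewrite !contract_tmap transpose1 !id_lfunE.
apply/pairing_sep => a; rewrite -pairing_transpose -!sharp_contract.
rewrite (skew_pairing _ _ skh) (skew_pairing _ _ skg) pairing_transpose.
by rewrite -!comp_lfunE eqT.
Qed.

(** Evaluated at [y], the two sides on the left are minus the pairings of [a] with the two sides on
    the right. *)
Lemma equivariant_coad :
  (forall x a, transpose psi (coad g x a) = coad h (phi x) (transpose psi a))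
  <-> (forall x y, psi [lie phi x, y] = [lie x, psi y]).
Proof.
split=> [eqv x y | eqv x a].
- apply/pairing_sep => a; apply: oppr_inj; rewrite -pairing_coad.
  by rewrite -!pairing_transpose eqv pairing_coad.
apply/dualP => y; rewrite pairing_transpose !pairing_coad pairing_transpose.
by rewrite eqv.
Qed.

Lemma coherent_hom_sharp : skew_symmetric rg -> skew_symmetric rh ->
  coherent_hom rg rh phi psi
  <-> O_operator_hom (coad g) (sharp rg) (coad h) (sharp rh) phi (transpose psi).
Proof.
move=> skg skh; split=> [[hom_phi eql _ eqv] | [hom_phi /equivariant_coad eqv eqT]].
- by split=> //; [exact/equivariant_coad | exact/intertwining_tmapl].
by split=> //; [exact/intertwining_tmapl | exact: intertwining_tmapr].
Qed.

End CoherentHom.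

(** * The functor given by [sharp] and its quasi-inverse *)

Section Equivalence.
Variable K : fieldType.

Definition sharp_hom (X Y : SCr K) (f : mor X Y) :
    mor (sharp_obj X) (sharp_obj Y) :=
  @OpHom K (op_of_sop (sharp_obj X)) (op_of_sop (sharp_obj Y)) (cr_phi f)
    (transpose (cr_psi f))
    ((coherent_hom_sharp _ _ (svalP X) (svalP Y)).1 (cr_homP f)).

Fact sharp_hom_id : preserves_id sharp_hom.
Proof. by move=> X; apply: op_hom_eq => //=; exact: transpose1. Qed.

Fact sharp_hom_comp : preserves_comp sharp_hom.
Proof. by move=> X Y Z f' f; apply: op_hom_eq => //=; exact: transpose_comp. Qed.

Fact r_matrix_sharp_inv (X : SOPcoad K) : r_matrix (sharp_inv (sop_map X)).
Proof.
apply: O_operator_r_matrix; first exact: skew_sharp_inv (@sop_skew K X).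
by rewrite sharp_invK; exact: sop_O_operator.
Qed.

(** Skewness makes [r + flip r] vanish. *)
Fact ad_invariant_sharp_inv (X : SOPcoad K) (r := sharp_inv (sop_map X)) :
  ad_invariant (r + flip r).
Proof.
move=> x; rewrite {1 3}/r {1 2}(skew_sharp_inv (@sop_skew K X)) -/r addNr.
by rewrite /tmap !linear0 addr0.
Qed.

Definition sharp_inv_obj (X : SOPcoad K) : SCr K :=
  exist _ (CrObj (r_matrix_sharp_inv X) (@ad_invariant_sharp_inv X))
    (skew_sharp_inv (@sop_skew K X)).

Fact sharp_inv_hom_subproof (X Y : SOPcoad K) (f : mor X Y) :
  coherent_hom (sharp_inv (sop_map X)) (sharp_inv (sop_map Y))
    (op_phi f) (untranspose (op_alpha f)).
Proof.
have [skX skY] := (skew_sharp_inv (@sop_skew K X), skew_sharp_inv (@sop_skew K Y)).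
apply/(coherent_hom_sharp _ _ skX skY); rewrite !sharp_invK untransposeK.
exact: (op_homP f).
Qed.

Definition sharp_inv_hom (X Y : SOPcoad K) (f : mor X Y) :
    mor (sharp_inv_obj X) (sharp_inv_obj Y) :=
  @CrHom K (sval (sharp_inv_obj X)) (sval (sharp_inv_obj Y)) _ _
    (sharp_inv_hom_subproof f).

Fact sharp_inv_hom_id : preserves_id sharp_inv_hom.
Proof.
move=> X; apply: cr_hom_eq => //=; apply: transpose_inj.
by rewrite untransposeK transpose1.
Qed.

Fact sharp_inv_hom_comp : preserves_comp sharp_inv_hom.
Proof.
move=> X Y Z f' f; apply: cr_hom_eq => //=; apply: transpose_inj.
by rewrite transpose_comp !untransposeK.
Qed.

Definition sharp_inv_functor : functor (SOPcoad K) (SCr K) :=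
  Functor sharp_inv_hom_id sharp_inv_hom_comp.

(** A round trip keeps the Lie algebra definitionally but the tensor only up to a proved equality,
    so the natural isomorphism has identity maps as components without being an identity
    morphism. *)
Lemma coherent_hom_1 (g : lieAlgType K) (r s : tensor g g) :
  r = s -> coherent_hom r s \1%VF \1%VF.
Proof.
move=> ->; split=> [x y|||x y]; rewrite ?id_lfunE //;
  by apply: eq_tmap => x; rewrite ?id_lfunE.
Qed.

Lemma O_operator_hom_1 (g : lieAlgType K) (V : vectType K)
    (rho : representation g V) (S T : 'Hom(V, g)) :
  S = T -> O_operator_hom rho S rho T \1%VF \1%VF.
Proof.
by move=> ->; split=> [x y|x v|]; rewrite ?id_lfunE // comp_lfun1l comp_lfun1r.
Qed.

Lemma sharp_equivalence : is_equivalence (Functor sharp_hom_id sharp_hom_comp).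
Proof.
exists sharp_inv_functor; split.
- pose A (X : SCr K) := sharp_inv_obj (sharp_obj X).
  have eqA (X : SCr K) : cr_tensor (sval (A X)) = cr_tensor (sval X).
    exact: sharpK.
  pose eta (X : SCr K) : mor (A X) X :=
    @CrHom K (sval (A X)) (sval X) _ _ (coherent_hom_1 (eqA X)).
  pose eta' (X : SCr K) : mor X (A X) :=
    @CrHom K (sval X) (sval (A X)) _ _ (coherent_hom_1 (esym (eqA X))).
  exists eta; split=> [X Y f | X].
    apply: cr_hom_eq; rewrite /= ?comp_lfun1l ?comp_lfun1r //.
    (* Naturality on [psi] says that transposing and untransposing returns it. *)
    exact: transposeK.
  by exists (eta' X); split; apply: cr_hom_eq; rewrite /= comp_lfun1l.
pose A (X : SOPcoad K) := sharp_obj (sharp_inv_obj X).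
have eqA (X : SOPcoad K) : sop_map (A X) = sop_map X by exact: sharp_invK.
pose eta (X : SOPcoad K) : mor (A X) X :=
  @OpHom K (op_of_sop (A X)) (op_of_sop X) _ _ (O_operator_hom_1 _ (eqA X)).
pose eta' (X : SOPcoad K) : mor X (A X) :=
  @OpHom K (op_of_sop X) (op_of_sop (A X)) _ _ (O_operator_hom_1 _ (esym (eqA X))).
exists eta; split=> [X Y f | X].
  apply: op_hom_eq; rewrite /= ?comp_lfun1l ?comp_lfun1r //.
  exact: untransposeK.
by exists (eta' X); split; apply: op_hom_eq; rewrite /= comp_lfun1l.
Qed.

End Equivalence.

Theorem theorem4p5 (K : fieldType) :
  (forall (g h : lieAlgType K) (rg : tensor g g) (rh : tensor h h),
     r_matrix rg -> skew_symmetric rg -> r_matrix rh -> skew_symmetric rh ->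
   forall (phi : 'Hom(g, h)) (psi : 'Hom(h, g)), lie_hom phi ->
     (coherent_hom rg rh phi psi
      <-> O_operator_hom (coad g) (sharp rg) (coad h) (sharp rh)
            phi (transpose psi)))
  /\
  (exists (F1 : forall X Y : SCr K,
             mor X Y -> mor (sharp_obj X) (sharp_obj Y))
          (F1id : preserves_id F1) (F1comp : preserves_comp F1),
     (forall (X Y : SCr K) (f : mor X Y),
        op_phi (F1 X Y f) = cr_phi f
        /\ op_alpha (F1 X Y f) = transpose (cr_psi f))
     /\ is_equivalence (Functor F1id F1comp)).
Proof.
split=> [g h rg rh _ skg _ skh phi psi _ | ]; first exact: coherent_hom_sharp.
exists (@sharp_hom K), (@sharp_hom_id K), (@sharp_hom_comp K).
by split=> //; exact: sharp_equivalence.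
Qed.
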